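(* Let $a < b$ be real numbers, let $f \in C[a,b]$, and let $\alpha > 0$ with $\alpha \notin \mathbb{N}$. Let $n = \lceil \alpha \rceil$ and $c_\alpha = \frac{\sin \pi\alpha}{\pi} \prod_{\ell=1}^{n-1} \frac{1}{\ell-\alpha}$. Let $\psi : \Omega \to (0,\infty)$ be an admissible transformation, and for $t \in [a,b]$, $\omega \in \Omega$ let $$\phi(t,\omega) = c_\alpha\, \psi'(\omega)\, (\psi(\omega))^{n-\alpha-1} \int_a^t (t-\tau)^{n-1} \exp(-(t-\tau)\psi(\omega))\, f(\tau)\, \mathrm{d}\tau .$$ Then: (1) If $\psi \in C^k(\Omega)$ with some $k \in \mathbb{N}$ then, for any $t \in [a,b]$, we have $\phi(t,\cdot) \in C^{k-1}(\Omega)$. (2) If $\psi \in C^\infty(\Omega)$ then, for any $t \in [a,b]$, we have $\phi(t,\cdot) \in C^\infty(\Omega)$.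
   Context: A function $\psi : \Omega \to (0,\infty)$ is called an admissible transformation if: (i) its domain $\Omega$ is a non-empty open interval of $\mathbb{R}$ (possibly unbounded); (ii) $\psi \in C^1(\Omega)$; (iii) $\psi$ is strictly monotonically increasing; (iv) $\lim_{\omega \to \inf\Omega} \psi(\omega) = 0$ and $\lim_{\omega \to \sup\Omega} \psi(\omega) = +\infty$. Here $\mathbb{N} = \{1,2,3,\ldots\}$, an empty product equals $1$, and $C^0(\Omega)$ denotes the continuous functions on $\Omega$. *)

(* Defs.v *)
From Stdlib Require Import Reals List Zfloor.
From Coquelicot Require Import Coquelicot.
Open Scope R_scope.

(* The open interval (lo, hi).  The nonempty open intervals of R, bounded or
   not, are exactly the Omega lo hi with [Rbar_lt lo hi], and then lo and hi
   are the infimum and supremum of Omega lo hi in the extended reals. *)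
Definition Omega (lo hi : Rbar) (x : R) : Prop := Rbar_lt lo x /\ Rbar_lt x hi.

(* C^k on a subset D of R.  Only used for open D, where the two-sided
   derivatives at points of D depend only on the values of g on D, so that the
   values of the total function g outside D are irrelevant.  For k = 0 this
   is continuity, since [ex_derive_n g 0 x] is [True]. *)
Definition C_k (k : nat) (D : R -> Prop) (g : R -> R) : Prop :=
  (forall (j : nat) (x : R), (j <= k)%nat -> D x -> ex_derive_n g j x) /\
  (forall x : R, D x -> continuous (Derive_n g k) x).

Definition C_infty (D : R -> Prop) (g : R -> R) : Prop :=
  forall k : nat, C_k k D g.

Definition admissible (lo hi : Rbar) (psi : R -> R) : Prop :=
  Rbar_lt lo hi /\
  (forall w : R, Omega lo hi w -> 0 < psi w) /\
  C_k 1 (Omega lo hi) psi /\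
  (forall w1 w2 : R, Omega lo hi w1 -> Omega lo hi w2 ->
     w1 < w2 -> psi w1 < psi w2) /\
  filterlim psi (within (Omega lo hi) (Rbar_locally lo)) (locally 0) /\
  filterlim psi (within (Omega lo hi) (Rbar_locally hi)) (Rbar_locally p_infty).

(* Used for alpha > 0 only, so that truncation by [Z.to_nat] plays no role. *)
Definition nceil (alpha : R) : nat := Z.to_nat (Zceil alpha).

Definition c_coef (alpha : R) : R :=
  sin (PI * alpha) / PI *
  fold_right Rmult 1
    (map (fun l : nat => 1 / (INR l - alpha)) (seq 1 (nceil alpha - 1))).

Definition phi (a alpha : R) (f psi : R -> R) (t w : R) : R :=
  c_coef alpha * Derive psi w * Rpower (psi w) (INR (nceil alpha) - alpha - 1) *
  RInt (fun tau : R =>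
          (t - tau) ^ (nceil alpha - 1) * exp (- (t - tau) * psi w) * f tau) a t.

(* Main.v *)
Require Import Defs.
From Stdlib Require Import Reals Lra Lia.
From Coquelicot Require Import Coquelicot.
Open Scope R_scope.

(** For fixed [t], the function [phi a alpha f psi t] is, up to the constant
    [c_coef alpha], the product of three factors:

      [Derive psi],  the power [Rpower (psi w) r],  and  [G (psi w)],

    where [G s] is the Laplace-type integral of
    [(t - tau) ^ (n - 1) * exp (- (t - tau) * s) * f tau] over [[a, t]].  The
    outer functions are smooth: real powers on the positive half-line, which
    contains the range of [psi] ([C_k_Rpower]), and [G] on all of [R], because
    differentiating under the integral sign only multiplies the continuous
    weight [(t - tau) ^ (n - 1) * f tau] by [- (t - tau)]
    ([is_derive_laplace], [C_k_laplace]).  Since C^k is stable under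
    composition and products ([C_k_comp], [C_k_mult]), both composite factors
    are as smooth as [psi], and the only loss of a derivative comes from the
    factor [Derive psi].

    All stability results are proved by induction on [k], by means of the
    recursive description of C^(k+1): being differentiable with a derivative
    of class C^k ([C_k_S_intro], [C_k_S_elim]). *)

(** * C^k functions on an open set *)

Lemma C_k_0 (D : R -> Prop) (g : R -> R) :
  C_k 0 D g <-> (forall x, D x -> continuous g x).
Proof.
  split.
  - intros [_ H]. exact H.
  - intros H. split; [ | exact H].
    intros j x Hj _. replace j with 0%nat by lia. exact I.
Qed.

Lemma Derive_n_Derive (g : R -> R) (j : nat) (x : R) :
  Derive_n (Derive g) j x = Derive_n g (S j) x.
Proof.
  change (Derive g) with (Derive_n g 1).
  rewrite Derive_n_comp. f_equal; lia.
Qed.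

Lemma ex_derive_n_Derive (g : R -> R) (j : nat) (x : R) :
  ex_derive_n (Derive g) (S j) x <-> ex_derive_n g (S (S j)) x.
Proof.
  split; apply ex_derive_ext; intros y; [ | symmetry];
    apply Derive_n_Derive.
Qed.

(** The defining conditions shift by one derivative. *)
Lemma C_k_S (k : nat) (D : R -> Prop) (g : R -> R) :
  C_k (S k) D g <->
  (forall x, D x -> ex_derive g x) /\ C_k k D (Derive g).
Proof.
  split.
  - intros [Hd Hc]. split; [ | split].
    + intros x Dx. exact (Hd 1%nat x ltac:(lia) Dx).
    + intros [ | j] x Hj Dx; [exact I | ].
      apply (proj2 (ex_derive_n_Derive g j x)). apply Hd; [lia | exact Dx].
    + intros x Dx. apply continuous_ext with (Derive_n g (S k)).
      * intros y. symmetry. apply Derive_n_Derive.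
      * exact (Hc x Dx).
  - intros [H1 [Hd Hc]]. split.
    + intros [ | [ | j]] x Hj Dx.
      * exact I.
      * exact (H1 x Dx).
      * apply (proj1 (ex_derive_n_Derive g j x)). apply Hd; [lia | exact Dx].
    + intros x Dx. apply continuous_ext with (Derive_n (Derive g) k).
      * intros y. apply Derive_n_Derive.
      * exact (Hc x Dx).
Qed.

(** Being C^k is a local property, so on an open set it only depends on the
    values taken there. *)
Lemma C_k_ext (k : nat) (D : R -> Prop) (g h : R -> R) :
  open D -> (forall x, D x -> g x = h x) -> C_k k D g -> C_k k D h.
Proof.
  intros HD. revert g h. induction k as [ | k IH]; intros g h Hgh.
  - rewrite !C_k_0. intros Hg x Dx.
    apply continuous_ext_loc with g; [ | exact (Hg x Dx)].
    generalize (HD x Dx). apply filter_imp. exact Hgh.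
  - rewrite !C_k_S. intros [Hd HC].
    assert (Hloc : forall x, D x -> locally x (fun y => g y = h y)).
    { intros x Dx. generalize (HD x Dx). apply filter_imp. exact Hgh. }
    split.
    + intros x Dx. apply ex_derive_ext_loc with g; auto.
    + apply IH with (Derive g); [ | exact HC].
      intros x Dx. apply Derive_ext_loc. auto.
Qed.

Lemma C_k_S_intro (k : nat) (D : R -> Prop) (g g' : R -> R) :
  open D -> (forall x, D x -> is_derive g x (g' x)) -> C_k k D g' ->
  C_k (S k) D g.
Proof.
  intros HD Hg HC. apply C_k_S. split.
  - intros x Dx. exists (g' x). auto.
  - apply C_k_ext with g'; [exact HD | | exact HC].
    intros x Dx. symmetry. apply is_derive_unique. auto.
Qed.

Lemma C_k_S_elim (k : nat) (D : R -> Prop) (g : R -> R) :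
  C_k (S k) D g ->
  (forall x, D x -> is_derive g x (Derive g x)) /\ C_k k D (Derive g).
Proof.
  rewrite C_k_S. intros [Hd HC]. split; [ | exact HC].
  intros x Dx. apply Derive_correct. auto.
Qed.

Lemma C_k_continuous (k : nat) (D : R -> Prop) (g : R -> R) (x : R) :
  C_k k D g -> D x -> continuous g x.
Proof.
  destruct k as [ | k]; intros HC Dx.
  - exact (proj1 (C_k_0 D g) HC x Dx).
  - apply (@ex_derive_continuous R_AbsRing R_NormedModule).
    exact (proj1 (proj1 (C_k_S k D g) HC) x Dx).
Qed.

Lemma C_k_pred (k : nat) (D : R -> Prop) (g : R -> R) :
  C_k (S k) D g -> C_k k D g.
Proof.
  intros HC. split.
  - intros j x Hj. apply (proj1 HC). lia.
  - intros x Dx. apply (@ex_derive_continuous R_AbsRing R_NormedModule).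
    exact (proj1 HC (S k) x (le_n _) Dx).
Qed.

(** * Stability under algebraic operations and composition *)

Lemma C_k_const (k : nat) (D : R -> Prop) (c : R) :
  open D -> C_k k D (fun _ => c).
Proof.
  intros HD. revert c. induction k as [ | k IH]; intros c.
  - apply C_k_0. intros x _. apply continuous_const.
  - apply C_k_S_intro with (fun _ => 0); auto.
    intros x _. apply (@is_derive_const R_AbsRing R_NormedModule).
Qed.

Lemma C_k_plus (k : nat) (D : R -> Prop) (g h : R -> R) :
  open D -> C_k k D g -> C_k k D h -> C_k k D (fun x => g x + h x).
Proof.
  intros HD. revert g h. induction k as [ | k IH]; intros g h Hg Hh.
  - apply C_k_0. intros x Dx.
    apply (@continuous_plus R_UniformSpace R_AbsRing R_NormedModule);
      eapply C_k_continuous; eauto.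
  - destruct (C_k_S_elim _ _ _ Hg) as [Dg Hg'].
    destruct (C_k_S_elim _ _ _ Hh) as [Dh Hh'].
    apply C_k_S_intro with (fun x => Derive g x + Derive h x); auto.
    intros x Dx.
    apply (@is_derive_plus R_AbsRing R_NormedModule); auto.
Qed.

(** The Leibniz rule turns C^(k+1) for a product into C^k for two products and
    their sum. *)
Lemma C_k_mult (k : nat) (D : R -> Prop) (g h : R -> R) :
  open D -> C_k k D g -> C_k k D h -> C_k k D (fun x => g x * h x).
Proof.
  intros HD. revert g h. induction k as [ | k IH]; intros g h Hg Hh.
  - apply C_k_0. intros x Dx.
    apply (@continuous_mult R_UniformSpace R_AbsRing);
      eapply C_k_continuous; eauto.
  - destruct (C_k_S_elim _ _ _ Hg) as [Dg Hg'].
    destruct (C_k_S_elim _ _ _ Hh) as [Dh Hh'].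
    apply C_k_S_intro with (fun x => Derive g x * h x + g x * Derive h x).
    + exact HD.
    + intros x Dx.
      apply (@is_derive_mult R_AbsRing); auto.
      intros n m. apply Rmult_comm.
    + apply C_k_plus; auto using C_k_pred.
Qed.

(** The chain rule writes the derivative of [F] after [g] as a product of a C^k
    function and a composition to which induction applies, with the derivative
    of [F] as outer function. *)
Lemma C_k_comp (k : nat) (D E : R -> Prop) (F g : R -> R) :
  open D -> (forall x, D x -> E (g x)) ->
  C_k k E F -> C_k k D g -> C_k k D (fun x => F (g x)).
Proof.
  intros HD HE. revert F. induction k as [ | k IH]; intros F HF Hg.
  - apply C_k_0. intros x Dx. apply continuous_comp.
    + eapply C_k_continuous; eauto.
    + eapply C_k_continuous; eauto.
  - destruct (C_k_S_elim _ _ _ Hg) as [Dg Hg'].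
    destruct (C_k_S_elim _ _ _ HF) as [DF HF'].
    apply C_k_S_intro with (fun x => Derive g x * Derive F (g x)).
    + exact HD.
    + intros x Dx.
      apply (@is_derive_comp R_AbsRing R_NormedModule F g); auto.
    + apply C_k_mult; auto using C_k_pred.
Qed.

(** * Smoothness of the outer functions *)

Lemma C_k_Rpower (k : nat) (r : R) :
  C_k k (fun x => 0 < x) (fun x => Rpower x r).
Proof.
  revert r. induction k as [ | k IH]; intros r.
  - apply C_k_0. intros x Dx.
    apply (@ex_derive_continuous R_AbsRing R_NormedModule).
    exists (r * Rpower x (r - 1)). apply is_derive_Reals.
    now apply derivable_pt_lim_power.
  - apply C_k_S_intro with (fun x => r * Rpower x (r - 1)).
    + apply open_gt.
    + intros x Dx. apply is_derive_Reals. now apply derivable_pt_lim_power.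
    + apply C_k_mult; [apply open_gt | apply C_k_const, open_gt | apply IH].
Qed.

(** Differentiation under the integral sign: the kernel has a derivative in [s]
    that is jointly continuous in [s] and [tau]. *)
Lemma is_derive_laplace (a t : R) (h : R -> R) (s : R) :
  (forall tau, continuous h tau) ->
  is_derive (fun s => RInt (fun tau => h tau * exp (- (t - tau) * s)) a t) s
    (RInt (fun tau => (h tau * - (t - tau)) * exp (- (t - tau) * s)) a t).
Proof.
  intros Hh.
  assert (HD : forall tau u,
    is_derive (fun z => h tau * exp (- (t - tau) * z)) u
      ((h tau * - (t - tau)) * exp (- (t - tau) * u))).
  { intros tau u. auto_derive; [exact I | ring]. }
  assert (HE : forall u tau, Derive (fun z => h tau * exp (- (t - tau) * z)) u
      = (h tau * - (t - tau)) * exp (- (t - tau) * u)).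
  { intros u tau. apply is_derive_unique, HD. }
  rewrite <- (RInt_ext
    (fun tau => Derive (fun z => h tau * exp (- (t - tau) * z)) s)).
  2: { intros tau _. apply HE. }
  apply (is_derive_RInt_param (fun s tau => h tau * exp (- (t - tau) * s))).
  - apply filter_forall. intros u tau _. eexists. apply HD.
  - intros tau _.
    apply continuity_2d_pt_ext with
      (fun u v => (h v * - (t - v)) * exp (- (t - v) * u)).
    { intros u v. symmetry. apply HE. }
    assert (Hlin : continuity_2d_pt (fun _ v => - (t - v)) s tau).
    { apply continuity_2d_pt_opp, continuity_2d_pt_minus.
      - apply continuity_2d_pt_const.
      - apply continuity_2d_pt_id2. }
    apply continuity_2d_pt_mult; [apply continuity_2d_pt_mult | ].
    + apply (continuity_1d_2d_pt_comp h (fun _ v => v)).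
      * apply continuity_pt_filterlim, Hh.
      * apply continuity_2d_pt_id2.
    + exact Hlin.
    + apply (continuity_1d_2d_pt_comp exp (fun u v => - (t - v) * u)).
      * apply derivable_continuous_pt, derivable_pt_exp.
      * apply continuity_2d_pt_mult; [exact Hlin | apply continuity_2d_pt_id1].
  - apply filter_forall. intros u.
    apply (@ex_RInt_continuous R_CompleteNormedModule). intros tau _.
    apply (@continuous_mult R_UniformSpace R_AbsRing).
    + apply Hh.
    + apply (@ex_derive_continuous R_AbsRing R_NormedModule).
      auto_derive. exact I.
Qed.

(** The derivative is an integral of the same shape with another continuous
    weight, whence the induction over all continuous weights [h]. *)
Lemma C_k_laplace (k : nat) (a t : R) (h : R -> R) :
  (forall tau, continuous h tau) ->
  C_k k (fun _ => True)
    (fun s => RInt (fun tau => h tau * exp (- (t - tau) * s)) a t).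
Proof.
  revert h. induction k as [ | k IH]; intros h Hh.
  - apply C_k_0. intros s _.
    apply (@ex_derive_continuous R_AbsRing R_NormedModule).
    eexists. now apply is_derive_laplace.
  - apply C_k_S_intro with
      (fun s => RInt (fun tau => (h tau * - (t - tau)) * exp (- (t - tau) * s))
                  a t).
    + apply open_true.
    + intros s _. now apply is_derive_laplace.
    + apply IH. intros tau.
      apply (@continuous_mult R_UniformSpace R_AbsRing); [apply Hh | ].
      apply (@ex_derive_continuous R_AbsRing R_NormedModule).
      auto_derive. exact I.
Qed.

(** * The transformed kernel *)

Lemma open_Omega (lo hi : Rbar) : open (Omega lo hi).
Proof.
  apply open_and; [apply open_Rbar_gt | apply open_Rbar_lt].
Qed.

(** Freezing [f] at its end values outside [[a, b]] yields a function that is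
    continuous everywhere, as the integrability and parameter lemmas ask for
    two-sided continuity also at the end points. *)
Lemma continuous_extension (a b : R) (f : R -> R) :
  a <= b -> continuous_on (fun x => a <= x <= b) f ->
  exists g : R -> R, (forall x, continuous g x) /\
    (forall x, a <= x <= b -> g x = f x).
Proof.
  intros hab hf.
  exists (fun x => f (Rmax a (Rmin b x))). split.
  - intros x.
    assert (Hin : forall y, a <= Rmax a (Rmin b y) <= b).
    { intros y. split; [apply Rmax_l | ].
      apply Rmax_lub; [exact hab | apply Rmin_l]. }
    unfold continuous.
    eapply filterlim_comp; [ | exact (hf _ (Hin x))].
    (* The clamp is 1-Lipschitz. *)
    intros P [eps HP]. exists eps. intros y Hy.
    apply HP; [ | apply Hin].
    apply Rle_lt_trans with (2 := Hy).
    unfold abs, minus, plus, opp; simpl.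
    unfold Rmax, Rmin.
    repeat destruct Rle_dec; unfold Rabs; repeat destruct Rcase_abs; lra.
  - intros x [H1 H2]. rewrite Rmin_right, Rmax_right; auto.
Qed.

(** One derivative is lost, to the factor [Derive psi]. *)
Lemma C_k_phi (k : nat) (a b alpha : R) (f psi : R -> R) (lo hi : Rbar) (t : R) :
  continuous_on (fun x => a <= x <= b) f ->
  (forall w, Omega lo hi w -> 0 < psi w) ->
  C_k (S k) (Omega lo hi) psi -> a <= t <= b ->
  C_k k (Omega lo hi) (phi a alpha f psi t).
Proof.
  intros hf Hpos Hpsi Ht.
  destruct (continuous_extension a b f) as [g [Hg Hgf]]; [lra | exact hf | ].
  pose proof (open_Omega lo hi) as HO.
  set (n := nceil alpha).
  apply C_k_ext with (fun w =>
    c_coef alpha * Derive psi w * Rpower (psi w) (INR n - alpha - 1) *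
    RInt (fun tau => ((t - tau) ^ (n - 1) * g tau) *
                     exp (- (t - tau) * psi w)) a t).
  - exact HO.
  - intros w _. unfold phi. fold n. f_equal.
    apply RInt_ext. intros tau. rewrite Rmin_left, Rmax_right by lra.
    intros Htau. rewrite Hgf by lra. simpl. ring.
  - apply C_k_mult; [exact HO | | ].
    + apply C_k_mult; [exact HO | | ].
      * apply C_k_mult; [exact HO | now apply C_k_const | ].
        exact (proj2 (C_k_S_elim _ _ _ Hpsi)).
      * apply (C_k_comp k (Omega lo hi) (fun x => 0 < x)
                 (fun x => Rpower x (INR n - alpha - 1)) psi);
          auto using C_k_Rpower, C_k_pred.
    + apply (C_k_comp k (Omega lo hi) (fun _ => True)
               (fun s => RInt (fun tau => ((t - tau) ^ (n - 1) * g tau) *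
                                          exp (- (t - tau) * s)) a t) psi);
        auto using C_k_pred.
      apply C_k_laplace. intros tau.
      apply (@continuous_mult R_UniformSpace R_AbsRing); [ | apply Hg].
      apply (@ex_derive_continuous R_AbsRing R_NormedModule).
      auto_derive. exact I.
Qed.

Theorem theorem4 (a b : R) (hab : a < b)
  (f : R -> R) (hf : continuous_on (fun x : R => a <= x <= b) f)
  (alpha : R) (halpha : 0 < alpha)
  (halphaN : forall m : nat, (1 <= m)%nat -> alpha <> INR m)
  (lo hi : Rbar) (psi : R -> R) (hpsi : admissible lo hi psi) :
  (forall k : nat, (1 <= k)%nat -> C_k k (Omega lo hi) psi ->
     forall t : R, a <= t <= b ->
       C_k (k - 1) (Omega lo hi) (phi a alpha f psi t)) /\
  (C_infty (Omega lo hi) psi ->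
     forall t : R, a <= t <= b ->
       C_infty (Omega lo hi) (phi a alpha f psi t)).
Proof.
  destruct hpsi as [_ [Hpos _]]. split.
  - intros k Hk Hpsi t Ht. apply C_k_phi with b; auto.
    replace (S (k - 1)) with k by lia. exact Hpsi.
  - intros Hpsi t Ht k. apply C_k_phi with b; auto.
Qed.
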